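(* Consider the finite Markov decision process, costs $c,d$, horizon $N\ge1$, Markov dynamic risk measure, threshold sets $\Phi_k(x)$, value functions $V_k$ and sets $F_k(x,r)$ defined in the context. Assume that the infimum $$\inf_{(u,r')\in F_k(x_k,r_k)}\Bigl\{c(x_k,u)+\sum_{x_{k+1}\in S}Q(x_{k+1}|x_k,u)\,V_{k+1}(x_{k+1},r'(x_{k+1}))\Bigr\}$$ is attained, and for each $k\in\{0,\dots,N-1\}$, $x_k\in S$ and $r_k\in\Phi_k(x_k)$ let $\bigl(u_k^*(x_k,r_k),\,r_k'(x_k,r_k)(\cdot)\bigr)\in F_k(x_k,r_k)$ be a minimizer (here $r'_k(x_k,r_k)(\cdot)$ is a function $S\to\mathbb{R}$). Let $x_0\in S$ and $r_0\in\Phi_0(x_0)$, and let $\pi\in\Pi$ be a policy defined recursively by $$\pi_0(x_0)=u_0^*(x_0,r_0),$$ $$\pi_k(h_{0,k})=u_k^*(x_k,r_k)\quad\text{with}\quad r_k=r'_{k-1}(x_{k-1},r_{k-1})(x_k),\qquad k\in\{1,\ldots,N-1\}.$$ Then $\pi$ is an optimal policy for the problem $$\min_{\pi\in\Pi}\;J_N^\pi(x_0)\quad\text{subject to}\quad R_N^\pi(x_0)\le r_0$$ with initial condition $x_0$ and constraint threshold $r_0$.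
   Context: **MDP and policies.** $S$ (states) and $U$ (controls) are finite sets; for each $x\in S$, $U(x)\subseteq U$ is the nonempty set of admissible controls; $Q(\cdot|x,u)$ is a probability distribution on $S$ for each $x\in S$, $u\in U(x)$. $c,d:S\times U\to\mathbb{R}$ are stage-wise costs and $N\ge1$ is the horizon. For $0\le k\le j\le N$, a (sub-)history is $h_{k,j}=(x_k,u_k,\ldots,x_{j-1},u_{j-1},x_j)$. $\Pi_k$ is the set of deterministic history-dependent policies $\pi=\{\pi_k,\pi_{k+1},\ldots\}$ with $\pi_j(h_{k,j})\in U(x_j)$ for all $j\ge k$ and all $h_{k,j}$; $\Pi=\Pi_0$. Only the components with index at most $N-1$ matter. Under $\pi\in\Pi_k$ started at $x_k$, $u_j=\pi_j(h_{k,j})$ and $x_{j+1}\sim Q(\cdot|x_j,u_j)$. **Markov dynamic risk measure.** For each $k\in\{0,\dots,N-1\}$ there is a map $\sigma_k$ assigning a real number $\sigma_k(V,x,Q(\cdot|x,u))$ to each $V:S\to\mathbb{R}$, $x\in S$, $u\in U(x)$, such that for fixed $(x,u)$ the map $\sigma(V)=\sigma_k(V,x,Q(\cdot|x,u))$ is a coherent risk measure: convex, i.e. $\sigma(\lambda V+(1-\lambda)W)\le\lambda\sigma(V)+(1-\lambda)\sigma(W)$ for $\lambda\in[0,1]$; monotone, i.e. $V\le W$ implies $\sigma(V)\le\sigma(W)$; translation invariant, i.e. $\sigma(a+V)=a+\sigma(V)$ for constants $a$; positively homogeneous, i.e. $\sigma(\lambda V)=\lambda\sigma(V)$ for $\lambda\ge0$.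 The one-step conditional risk measure at stage $k$ is $\rho_k(V(x_{k+1}))=\sigma_k(V,x_k,Q(\cdot|x_k,u_k))$; for functions of $x_{k+1}$ that also depend on the history up to stage $k$, it is applied with that history (and $u_k$) held fixed. The dynamic risk measure is $$\rho_{k,N}(Z_k,\ldots,Z_N)=Z_k+\rho_k\bigl(Z_{k+1}+\rho_{k+1}(Z_{k+2}+\cdots+\rho_{N-2}(Z_{N-1}+\rho_{N-1}(Z_N))\cdots)\bigr).$$ **Cost and risk of tail processes.** For $k\in\{0,\dots,N-1\}$, $x_k\in S$, $\pi\in\Pi_k$: $$J_N^\pi(x_k)=\mathbb{E}\Bigl[\sum_{j=k}^{N-1}c(x_j,u_j)\Bigr],\qquad R_N^\pi(x_k)=\rho_{k,N}\bigl(d(x_k,u_k),\ldots,d(x_{N-1},u_{N-1}),0\bigr),$$ both computed for the process started at stage $k$ from $x_k$ under $\pi$. **Thresholds.** $\underline R_N(x_k)=\min_{\pi\in\Pi_k}R_N^\pi(x_k)$ (for the tail starting at stage $k$); $\rho_{\max}=\max_{k\in\{0,\dots,N-1\}}\max_{(x,u)\in S\times U}\rho_k(d(x,u))$, with $d(x,u)$ regarded as a constant (so $\rho_k(d(x,u))=d(x,u)$); $\overline R_N^{(k)}=(N-k)\rho_{\max}$. Set $\Phi_k(x_k)=[\underline R_N(x_k),\overline R_N^{(k)}]$ for $k<N$ and $\Phi_N(x_N)=\{0\}$. **Value functions.** $\overline C$ is a fixed large constant, namely an upper bound on the $N$-stage cost. - If $k<N$ and $r_k\in\Phi_k(x_k)$: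 $V_k(x_k,r_k)=\min\{J_N^\pi(x_k):\pi\in\Pi_k,\ R_N^\pi(x_k)\le r_k\}$. - If $k\le N$ and $r_k\notin\Phi_k(x_k)$: $V_k(x_k,r_k)=\overline C$. - $V_N(x_N,0)=0$. **Control/threshold pairs.** For $k\in\{0,\dots,N-1\}$, $F_k(x_k,r_k)$ is the set of pairs $(u,r')$ with $u\in U(x_k)$ and $r':S\to\mathbb{R}$ such that $r'(x')\in\Phi_{k+1}(x')$ for all $x'\in S$ and $d(x_k,u)+\rho_k(r'(x_{k+1}))\le r_k$, where $\rho_k(r'(x_{k+1}))=\sigma_k(r',x_k,Q(\cdot|x_k,u))$. **Optimality.** A policy is optimal for the constrained problem if it satisfies the constraint and attains the minimal cost among all policies in $\Pi$ satisfying the constraint. *)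

(* Defs.v *)
From HB Require Import structures.
From mathcomp Require Import all_boot all_order all_algebra.
From mathcomp Require Import all_classical all_reals.

Set Implicit Arguments.
Unset Strict Implicit.
Unset Printing Implicit Defensive.

Import Order.TTheory GRing.Theory Num.Theory.
Local Open Scope classical_set_scope.
Local Open Scope ring_scope.

(* [kern m x u y] is Q(y | x, u); nothing is assumed about it, and about the
   costs, when [u] is not admissible at [x]. *)
Record mdp (R : realType) (S U : finType) := MDP {
  ctrl : S -> {set U};
  ctrl_neq0 : forall x, ctrl x != finset.set0;
  kern : S -> U -> S -> R;
  kern_ge0 : forall x u y, u \in ctrl x -> 0 <= kern x u y;
  kern_sum1 : forall x u, u \in ctrl x -> \sum_(y : S) kern x u y = 1;
  cost : S -> U -> R;
  dcost : S -> U -> R }.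

Definition coherent (R : realType) (S : finType) (rho : (S -> R) -> R) : Prop :=
  [/\ forall (l : R) V W, 0 <= l -> l <= 1 ->
        rho (fun x => l * V x + (1 - l) * W x) <= l * rho V + (1 - l) * rho W,
      forall V W, (forall x, V x <= W x) -> rho V <= rho W,
      forall (a : R) V, rho (fun x => a + V x) = a + rho V
    & forall (l : R) V, 0 <= l -> rho (fun x => l * V x) = l * rho V].

(* The sub-history (x_k, u_k, ..., x_{j-1}, u_{j-1}, x_j) is the pair of
   [:: (x_k, u_k); ...; (x_{j-1}, u_{j-1})] and x_j.  For a policy started at
   stage k, [pi h x] is pi_j(h_{k,j}) with j = k + size h: the stage is read off
   the history, so that one type serves the policy sets Pi_k of all stages. *)
Definition policy (S U : finType) := seq (S * U) -> S -> U.

Section ConstrainedMDP.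
Context {R : realType} {S U : finType}.
Variables (M : mdp R S U) (N : nat).
(* [sigma k V x q] is sigma_k(V, x, q), used with q = Q(. | x, u). *)
Variable sigma : nat -> (S -> R) -> S -> (S -> R) -> R.

Definition admissible : set (policy S U) :=
  [set pi | forall h x, pi h x \in ctrl M x].

Definition markov_risk_measure : Prop :=
  forall k x u, (k < N)%N -> u \in ctrl M x ->
    coherent (fun V => sigma k V x (kern M x u)).

(* [xs i] and [control pi xs i] are the state and control at the i-th step
   after the starting stage. *)
Fixpoint history (pi : policy S U) (xs : nat -> S) (i : nat) : seq (S * U) :=
  if i is i'.+1 then
    rcons (history pi xs i') (xs i', pi (history pi xs i') (xs i'))
  else [::].

Definition control (pi : policy S U) (xs : nat -> S) (i : nat) : U :=
  pi (history pi xs i) (xs i).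

(* Expectation under the law of the trajectory (x_k, ..., x_N) started from
   x_k = x; the tuple [y] lists the successor states x_{k+1}, ..., x_N. *)
Definition J (k : nat) (pi : policy S U) (x : S) : R :=
  \sum_(y : (N - k).-tuple S)
    let xs := nth x (x :: y) in
    (\prod_(i < N - k) kern M (xs i) (control pi xs i) (xs i.+1)) *
    (\sum_(i < N - k) cost M (xs i) (control pi xs i)).

(* rho_{j,j+n}(Z_j, ..., Z_{j+n}) for the process under [pi], at the history
   (h, x) up to stage j; each [Z i] is a function of the history up to stage i.
   One-step measures are applied with the history and the control held fixed. *)
Fixpoint dyn_risk (pi : policy S U) (Z : nat -> seq (S * U) -> S -> R)
    (n j : nat) (h : seq (S * U)) (x : S) : R :=
  if n is n'.+1 then
    Z j h x +
    sigma j (fun y => dyn_risk pi Z n' j.+1 (rcons h (x, pi h x)) y)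
      x (kern M x (pi h x))
  else Z j h x.

Definition risk (k : nat) (pi : policy S U) (x : S) : R :=
  dyn_risk pi (fun j h y => if (j < N)%N then dcost M y (pi h y) else 0)
    (N - k) k [::] x.

(* The [inf] and [sup] below range over finitely many values, since only
   histories with fewer than N transitions matter; they are the min and max. *)
Definition risk_min (k : nat) (x : S) : R :=
  inf [set risk k pi x | pi in admissible].

(* rho_k of the constant d(x,u) is d(x,u), for every k < N. *)
Definition rho_max : R := sup [set dcost M xu.1 xu.2 | xu in [set: S * U]].

Definition risk_max (k : nat) : R := (N - k)%:R * rho_max.

Definition Phi (k : nat) (x : S) : set R :=
  if (k < N)%N then [set r | risk_min k x <= r <= risk_max k] else [set 0].

Definition V (Cbar : R) (k : nat) (x : S) (r : R) : R :=
  if `[< Phi k x r >] then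
    if (k < N)%N then
      inf [set J k pi x | pi in [set pi | admissible pi /\ risk k pi x <= r]]
    else 0
  else Cbar.

Definition F (k : nat) (x : S) (r : R) : set (U * (S -> R)) :=
  [set p | [/\ p.1 \in ctrl M x,
               forall y, Phi k.+1 y (p.2 y)
             & dcost M x p.1 + sigma k p.2 x (kern M x p.1) <= r]].

Definition dp_objective (Cbar : R) (k : nat) (x : S) (p : U * (S -> R)) : R :=
  cost M x p.1 + \sum_(y : S) kern M x p.1 y * V Cbar k.+1 y (p.2 y).

Definition dp_minimizer (Cbar : R) (k : nat) (x : S) (r : R)
    (p : U * (S -> R)) : Prop :=
  F k x r p /\
  forall q, F k x r q -> dp_objective Cbar k x p <= dp_objective Cbar k x q.

Definition optimal (x0 : S) (r0 : R) (pi : policy S U) : Prop :=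
  [/\ admissible pi, risk 0 pi x0 <= r0
    & forall pi', admissible pi' -> risk 0 pi' x0 <= r0 ->
        J 0 pi x0 <= J 0 pi' x0].

End ConstrainedMDP.

(* The threshold r_k along the states x_0, x_1, ...: it starts at [r0], and
   r_{k+1} = r'_k(x_k, r_k)(x_{k+1}). *)
Fixpoint threshold (R : realType) (S : finType) (rstar : nat -> S -> R -> S -> R)
    (r0 : R) (xs : nat -> S) (k : nat) : R :=
  if k is k'.+1 then
    rstar k' (xs k') (threshold rstar r0 xs k') (xs k'.+1)
  else r0.

(* Main.v *)
Require Import Defs.
From HB Require Import structures.
From mathcomp Require Import all_boot all_order all_algebra.
From mathcomp Require Import all_classical all_reals.

(** By the tail recursions for J and risk, an arbitrary feasible policy yields
    the pair (its first control, the risks of its tails), which lies in F and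
    whose dynamic programming objective is at most its cost.  Backward induction
    on the stage then shows that a policy following the minimizers meets its
    threshold, by monotonicity of the risk measure, and costs no more than any
    feasible competitor.  The tails of the policy are themselves feasible, so V
    is the infimum of a nonempty set that they bound from below. *)

Set Implicit Arguments.
Unset Strict Implicit.
Unset Printing Implicit Defensive.

Import Order.TTheory GRing.Theory Num.Theory.
Local Open Scope classical_set_scope.
Local Open Scope ring_scope.

(** * Splitting off a first entry, and finite bounds *)

Lemma mkseqS_cons (T : Type) (f : nat -> T) n :
  mkseq f n.+1 = f 0%N :: mkseq (f \o succn) n.
Proof. by rewrite /mkseq /= (iotaDl 1 0) -map_comp. Qed.

Lemma big_tuple_cons (R : nmodType) (T : finType) n (f : n.+1.-tuple T -> R) :
  \sum_(t : n.+1.-tuple T) f t = \sum_(y : T) \sum_(t : n.-tuple T) f [tuple of y :: t].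
Proof.
rewrite pair_big /= (reindex (fun p : T * n.-tuple T => [tuple of p.1 :: p.2])) //=.
exists (fun t => (thead t, [tuple of behead t])) => [[y t] _|t _] /=.
  by congr (_, _); apply: val_inj.
by rewrite [RHS]tuple_eta.
Qed.

Lemma finite_norm_bounded (R : numDomainType) (T : finType) (f : T -> R) :
  exists b, forall t, `|f t| <= b.
Proof.
by exists (\sum_t `|f t|) => t; rewrite (bigD1 t) //= lerDl sumr_ge0.
Qed.

(** * Constants and bounds under a coherent risk measure *)

Section CoherentBounds.
Context {R : realType} {S : finType} (rho : (S -> R) -> R).
Hypothesis rho_coh : coherent rho.

(** Homogeneity with factor 0 gives the value 0 on the zero function; translation invariance then
    shifts it by [a]. *)
Lemma coherent_cst a : rho (fun=> a) = a.
Proof.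
case: rho_coh => _ _ tr hom.
have rho0 : rho (fun=> 0) = 0.
  rewrite -[RHS](mul0r (rho (fun=> 0))) -hom //.
  by congr rho; apply/funext => x; rewrite mul0r.
rewrite -[RHS]addr0 -rho0 -tr.
by congr rho; apply/funext => x; rewrite addr0.
Qed.

Lemma coherent_le W a : (forall x, W x <= a) -> rho W <= a.
Proof. by case: rho_coh => _ mono _ _ Wa; rewrite -(coherent_cst a) mono. Qed.

Lemma coherent_ge W a : (forall x, a <= W x) -> a <= rho W.
Proof. by case: rho_coh => _ mono _ _ Wa; rewrite -{1}(coherent_cst a) mono. Qed.

End CoherentBounds.

(** What remains of [pi] after the first transition [p]; as the stage is read off the history,
    prefixing [p] also shifts the stage by one. *)
Definition tail_policy (S U : finType) (pi : policy S U) (p : S * U) : policy S U :=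
  fun h => pi (p :: h).

(** * Recursion of cost and risk on the first transition *)

Section TailRecursion.
Context {R : realType} {S U : finType}.
Variables (M : mdp R S U) (N : nat).
Variable sigma : nat -> (S -> R) -> S -> (S -> R) -> R.
Implicit Types (pi : policy S U) (x y : S) (xs : nat -> S).

Lemma admissible_tail pi p : admissible M pi -> admissible M (tail_policy pi p).
Proof. by move=> adm h x; exact: adm. Qed.

(** Histories grow at the right end, while the tail recursion peels off the left end; induction
    reconciles the two. *)
Lemma history_tail pi xs i :
  history pi xs i.+1 =
  (xs 0%N, pi [::] (xs 0%N)) ::
    history (tail_policy pi (xs 0%N, pi [::] (xs 0%N))) (xs \o succn) i.
Proof. by elim: i => [//|i IH]; rewrite [LHS]/= -/(history pi xs i.+1) IH. Qed.

Lemma control_tail pi xs i :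
  control pi xs i.+1 =
  control (tail_policy pi (xs 0%N, pi [::] (xs 0%N))) (xs \o succn) i.
Proof. by rewrite /control history_tail. Qed.

Lemma eq_control pi xs xs' i : (forall j, (j <= i)%N -> xs j = xs' j) ->
  control pi xs i = control pi xs' i.
Proof.
move=> eq_xs; rewrite /control eq_xs //; congr (pi _ _).
elim: i eq_xs => //= i IH eq_xs.
by rewrite IH ?eq_xs // => j ji; rewrite eq_xs // (leq_trans ji).
Qed.

Definition path_prob n pi xs : R :=
  \prod_(i < n) kern M (xs i) (control pi xs i) (xs i.+1).

Definition path_cost n pi xs : R := \sum_(i < n) cost M (xs i) (control pi xs i).

Lemma path_prob_cons n pi x y (t : n.-tuple S) (u := pi [::] x) :
  path_prob n.+1 pi (nth x [:: x, y & t]) =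
  kern M x u y * path_prob n (tail_policy pi (x, u)) (nth y (y :: t)).
Proof.
rewrite /path_prob big_ord_recl; congr (_ * _).
apply: eq_bigr => i _; rewrite lift0 control_tail.
(* The lookups with defaults [x] and [y] agree only inside [y :: t]; every index used here stays in
   that range. *)
have lt_in j : (j <= i)%N -> (j < size (y :: t))%N.
  by move=> ji; rewrite /= size_tuple ltnS (leq_trans ji) // ltnW.
congr (kern M _ _ _).
- by rewrite -(set_nth_default y x) ?lt_in.
- by apply: eq_control => j ji; rewrite -(set_nth_default y x) ?lt_in.
- by apply: (@set_nth_default _ (y :: t) y x i.+1); rewrite /= size_tuple ltnS.
Qed.

Lemma path_cost_cons n pi x y (t : n.-tuple S) (u := pi [::] x) :
  path_cost n.+1 pi (nth x [:: x, y & t]) =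
  cost M x u + path_cost n (tail_policy pi (x, u)) (nth y (y :: t)).
Proof.
rewrite /path_cost big_ord_recl; congr (_ + _).
apply: eq_bigr => i _; rewrite lift0 control_tail.
have lt_in j : (j <= i)%N -> (j < size (y :: t))%N.
  by move=> ji; rewrite /= size_tuple ltnS (leq_trans ji) // ltnW.
congr (cost M _ _).
- by rewrite -(set_nth_default y x) ?lt_in.
- by apply: eq_control => j ji; rewrite -(set_nth_default y x) ?lt_in.
Qed.

(** Used to pull the first-stage cost, constant along the tail, out of the expectation. *)
Lemma path_prob_sum1 n pi x : admissible M pi ->
  \sum_(t : n.-tuple S) path_prob n pi (nth x (x :: t)) = 1.
Proof.
elim: n pi x => [|n IH] pi x adm.
  rewrite (big_pred1 [tuple]) ?/path_prob ?big_ord0 // => t.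
  by rewrite [t]tuple0; apply/esym/eqP/val_inj.
rewrite big_tuple_cons -[RHS](kern_sum1 (adm [::] x)); apply: eq_bigr => y _.
under eq_bigr do rewrite path_prob_cons.
by rewrite -mulr_sumr IH ?mulr1 //; exact: admissible_tail.
Qed.

Lemma JE k pi x : J M N k pi x =
  \sum_(t : (N - k).-tuple S)
    path_prob (N - k) pi (nth x (x :: t)) * path_cost (N - k) pi (nth x (x :: t)).
Proof. by []. Qed.

Lemma J_end pi x : J M N N pi x = 0.
Proof.
rewrite JE subnn big1 // => t _.
by rewrite /path_cost big_ord0 mulr0.
Qed.

Lemma J_step k pi x (u := pi [::] x) : (k < N)%N -> admissible M pi ->
  J M N k pi x =
  cost M x u + \sum_y kern M x u y * J M N k.+1 (tail_policy pi (x, u)) y.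
Proof.
move=> kN adm; rewrite !JE -(subnSK kN) big_tuple_cons.
(* As an average over successors, the first cost can be compared term by term in [y]. *)
have -> : cost M x u = \sum_y kern M x u y * cost M x u.
  by rewrite -mulr_suml (kern_sum1 (adm [::] x)) mul1r.
rewrite -big_split /=; apply: eq_bigr => y _; rewrite -mulrDr JE.
under eq_bigr do rewrite path_prob_cons path_cost_cons -mulrA mulrDr.
rewrite -mulr_sumr big_split /= -mulr_suml path_prob_sum1 ?mul1r //.
exact: admissible_tail.
Qed.

(** The recursion only appends to the history, so a leading [p] can be moved into the policy. *)
Lemma dyn_risk_tail pi p n j h y :
  dyn_risk M sigma pi (fun j h y => if (j < N)%N then dcost M y (pi h y) else 0)
    n j (p :: h) y =
  dyn_risk M sigma (tail_policy pi p)
    (fun j h y => if (j < N)%N then dcost M y (tail_policy pi p h y) else 0)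
    n j h y.
Proof.
elim: n j h y => [//|n IH] j h y /=; congr (_ + sigma _ _ _ _).
by apply/funext => z; rewrite -rcons_cons IH.
Qed.

Lemma risk_end pi x : risk M N sigma N pi x = 0.
Proof. by rewrite /risk subnn /= ltnn. Qed.

Lemma risk_step k pi x (u := pi [::] x) : (k < N)%N ->
  risk M N sigma k pi x =
  dcost M x u +
  sigma k (risk M N sigma k.+1 (tail_policy pi (x, u))) x (kern M x u).
Proof.
move=> kN; rewrite /risk -(subnSK kN) /= kN; congr (_ + sigma _ _ _ _).
by apply/funext => y; rewrite dyn_risk_tail.
Qed.

(** Backward induction on the stage, run as ordinary induction on [N - k]. *)
Lemma tail_ind (P : nat -> Prop) :
  P N -> (forall k, (k < N)%N -> P k.+1 -> P k) -> forall k, (k <= N)%N -> P k.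
Proof.
move=> PN PS k kN; rewrite -(subKn kN); elim: (N - k)%N (leq_subr k N) => [|n IH] nN.
  by rewrite subn0.
by apply: PS; rewrite subnSK ?leq_subr //; apply: IH; exact: ltnW.
Qed.

Lemma kern_avg_ge x u a W : u \in ctrl M x -> (forall y, a <= W y) ->
  a <= \sum_y kern M x u y * W y.
Proof.
move=> xu aW; have {1}-> : a = \sum_y kern M x u y * a.
  by rewrite -mulr_suml (kern_sum1 xu) mul1r.
by apply: ler_sum => y _; apply: ler_wpM2l => //; exact: kern_ge0.
Qed.

Lemma J_lbound k x : (k <= N)%N ->
  exists b, forall pi, admissible M pi -> b <= J M N k pi x.
Proof.
have [b bP] := finite_norm_bounded (fun p : S * U => cost M p.1 p.2).
(* One [- b] per remaining stage; the bound is fixed before [pi], as the infimum over policies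
   requires. *)
move=> kN; exists (- ((N - k)%:R * b)) => pi; move: k kN pi x.
apply: tail_ind => [pi x _|k kN IH pi x adm].
  by rewrite J_end subnn mul0r oppr0.
rewrite J_step // -(subnSK kN) mulrSr mulrDl mul1r opprD addrC lerD //.
  by have := bP (x, pi [::] x); rewrite ler_norml => /andP[].
apply: (kern_avg_ge (adm [::] x)) => y.
by apply: IH; exact: admissible_tail.
Qed.

Hypothesis hsigma : markov_risk_measure M N sigma.

Lemma risk_lbound k x : (k <= N)%N ->
  exists b, forall pi, admissible M pi -> b <= risk M N sigma k pi x.
Proof.
have [b bP] := finite_norm_bounded (fun p : S * U => dcost M p.1 p.2).
move=> kN; exists (- ((N - k)%:R * b)) => pi; move: k kN pi x.
apply: tail_ind => [pi x _|k kN IH pi x adm].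
  by rewrite risk_end subnn mul0r oppr0.
rewrite risk_step // -(subnSK kN) mulrSr mulrDl mul1r opprD addrC lerD //.
  by have := bP (x, pi [::] x); rewrite ler_norml => /andP[].
apply: (coherent_ge (hsigma kN (adm [::] x))) => y.
by apply: IH; exact: admissible_tail.
Qed.

Lemma dcost_le_rho_max x u : dcost M x u <= rho_max M.
Proof.
have [b bP] := finite_norm_bounded (fun p : S * U => dcost M p.1 p.2).
apply: ub_le_sup; last by exists (x, u).
by exists b => _ [p _ <-]; exact: le_trans (ler_norm _) (bP p).
Qed.

Lemma risk_le_max k x pi : (k <= N)%N -> admissible M pi ->
  risk M N sigma k pi x <= risk_max M N k.
Proof.
move=> kN; move: k kN pi x; rewrite /risk_max.
apply: tail_ind => [pi x _|k kN IH pi x adm].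
  by rewrite risk_end subnn mul0r.
rewrite risk_step // -(subnSK kN) mulrSr mulrDl mul1r addrC lerD ?dcost_le_rho_max //.
apply: (coherent_le (hsigma kN (adm [::] x))) => y.
by apply: IH; exact: admissible_tail.
Qed.

(** This makes the risks of tails legitimate thresholds, including at stage [N], where both sides
    reduce to 0. *)
Lemma risk_Phi k x pi : (k <= N)%N -> admissible M pi ->
  Phi M N sigma k x (risk M N sigma k pi x).
Proof.
move=> kN adm; rewrite /Phi; case: ltnP => [_|Nk] /=; last first.
  by have -> : k = N; [apply/eqP; rewrite eqn_leq kN | exact: risk_end].
rewrite risk_le_max // andbT; apply: inf_lbound; last by exists pi.
by have [b bP] := risk_lbound x kN; exists b => _ [pi' adm' <-]; exact: bP.
Qed.

Lemma V_le_J Cbar k x pi r : (k <= N)%N -> admissible M pi ->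
  Phi M N sigma k x r -> risk M N sigma k pi x <= r ->
  V M N sigma Cbar k x r <= J M N k pi x.
Proof.
move=> kN adm Phir risk_r; rewrite /V asboolT //; case: ltnP => [_|Nk]; last first.
  by have -> : k = N; [apply/eqP; rewrite eqn_leq kN | rewrite J_end].
apply: inf_lbound; last by exists pi.
by have [b bP] := J_lbound x kN; exists b => _ [pi' [adm' _] <-]; exact: bP.
Qed.

Lemma dp_objective_le_J Cbar k x pi r : (k < N)%N -> admissible M pi ->
  risk M N sigma k pi x <= r ->
  exists2 p, F M N sigma k x r p & dp_objective M N sigma Cbar k x p <= J M N k pi x.
Proof.
move=> kN adm risk_r; set u := pi [::] x.
have adm_t : admissible M (tail_policy pi (x, u)) by exact: admissible_tail.
(* With its own risk as threshold, each tail is feasible, with equality. *)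
exists (u, risk M N sigma k.+1 (tail_policy pi (x, u))).
  split=> [|y|]; [exact: adm | exact: risk_Phi | by rewrite -risk_step].
rewrite J_step // lerD2l; apply: ler_sum => y _.
apply: ler_wpM2l; first exact/kern_ge0/adm.
by apply: V_le_J => //; exact: risk_Phi.
Qed.

(** * Policies that follow the minimizers *)

Section Follows.
Variables (Cbar : R) (ustar : nat -> S -> R -> U) (rstar : nat -> S -> R -> S -> R).
Hypothesis hstar : forall k x r, (k < N)%N -> Phi M N sigma k x r ->
  dp_minimizer M N sigma Cbar k x r (ustar k x r, rstar k x r).

(** The recorded controls [us] are arbitrary, not only those chosen by [pi], so the property passes
    to the tail after any first control. *)
Definition follows k x r pi : Prop :=
  forall xs us i, xs 0%N = x -> (k + i < N)%N ->
    pi (mkseq (fun j => (xs j, us j)) i) (xs i) =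
    ustar (k + i) (xs i) (threshold (fun j => rstar (k + j)) r xs i).

(** Unrolls the threshold at its first step instead of its last, matching a restart at stage
    [k.+1]. *)
Lemma threshold_tail k r xs i :
  threshold (fun j => rstar (k + j)) r xs i.+1 =
  threshold (fun j => rstar (k.+1 + j)) (rstar k (xs 0%N) r (xs 1%N)) (xs \o succn) i.
Proof. by elim: i => [|i IH]; rewrite /= ?addn0 // addSnnS -IH. Qed.

Lemma follows_head k x r pi : (k < N)%N -> follows k x r pi ->
  pi [::] x = ustar k x r.
Proof.
by move=> kN /(_ (fun=> x) (fun=> pi [::] x) 0%N erefl); rewrite addn0 => /(_ kN).
Qed.

Lemma follows_tail k x r pi u y : follows k x r pi ->
  follows k.+1 y (rstar k x r y) (tail_policy pi (x, u)).
Proof.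
move=> fol xs us i xs0 iN.
(* Prefixing [x] and [u] turns a trajectory of the tail at step [i] into one of [pi] at step
   [i.+1]. *)
pose cons_seq T (a : T) f n := if n is n'.+1 then f n' else a.
have := fol (cons_seq _ x xs) (cons_seq _ u us) i.+1 erefl.
rewrite -addSnnS => /(_ iN).
by rewrite threshold_tail mkseqS_cons /= xs0.
Qed.

(** Both claims go through one induction: the cost bound at a stage uses the feasibility of the
    tails at the next. *)
Lemma follows_optimal k x r pi : (k <= N)%N -> Phi M N sigma k x r ->
  admissible M pi -> follows k x r pi ->
  risk M N sigma k pi x <= r /\
  forall pi', admissible M pi' -> risk M N sigma k pi' x <= r ->
    J M N k pi x <= J M N k pi' x.
Proof.
move=> kN; move: k kN x r pi; apply: tail_ind => [x r pi|k kN IH x r pi Phir adm fol].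
  rewrite /Phi ltnn => -> _ _; rewrite risk_end lexx.
  by split=> // pi' _ _; rewrite !J_end.
have [[/= ustar_ctrl rstar_Phi rstar_risk] dp_min] := hstar kN Phir.
have pi_x := follows_head kN fol.
set u := pi [::] x in pi_x.
have adm_t : admissible M (tail_policy pi (x, u)) by exact: admissible_tail.
have tail_opt y := IH y _ _ (rstar_Phi y) adm_t (follows_tail u fol).
split=> [|pi' adm' risk'_r].
  apply: le_trans rstar_risk; rewrite risk_step // -/u -[in leRHS]pi_x lerD2l.
  have [_ mono _ _] := hsigma kN (adm [::] x).
  by apply: mono => y; have [] := tail_opt y.
have [p Fp /(le_trans (dp_min _ Fp))] := dp_objective_le_J Cbar kN adm' risk'_r.
apply: le_trans; rewrite J_step // -/u /dp_objective /= -pi_x lerD2l.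
apply: ler_sum => y _; apply: ler_wpM2l; first exact/kern_ge0/adm.
have [tail_risk tail_J] := tail_opt y.
(* The next threshold lies in [Phi] because the minimizer lies in [F], so [V] does not take the
   default [Cbar]. *)
rewrite /V asboolT //; case: ltnP => [_|Nk]; last first.
  by have -> : k.+1 = N; [apply/eqP; rewrite eqn_leq kN | rewrite J_end].
apply: lb_le_inf.
  by exists (J M N k.+1 (tail_policy pi (x, u)) y), (tail_policy pi (x, u)).
by move=> _ [pi'' [adm'' risk''] <-]; exact: tail_J.
Qed.

End Follows.
End TailRecursion.

Theorem theoremV1 (R : realType) (S U : finType) (M : mdp R S U) (N : nat)
    (sigma : nat -> (S -> R) -> S -> (S -> R) -> R) (Cbar : R)
    (ustar : nat -> S -> R -> U) (rstar : nat -> S -> R -> S -> R)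
    (x0 : S) (r0 : R) (pi : policy S U)
    (hN : (1 <= N)%N)
    (hsigma : markov_risk_measure M N sigma)
    (hCbar : forall pi' x, admissible M pi' -> J M N 0 pi' x <= Cbar)
    (hstar : forall k x r, (k < N)%N -> Phi M N sigma k x r ->
       dp_minimizer M N sigma Cbar k x r (ustar k x r, rstar k x r))
    (hr0 : Phi M N sigma 0 x0 r0)
    (hadm : admissible M pi)
    (hpi : forall (xs : nat -> S) (us : nat -> U) (k : nat),
       xs 0%N = x0 -> (k < N)%N ->
       pi (mkseq (fun i => (xs i, us i)) k) (xs k) =
       ustar k (xs k) (threshold rstar r0 xs k)) :
  optimal M N sigma x0 r0 pi.
Proof.
have fol : follows N ustar rstar 0 x0 r0 pi by exact: hpi.
by have [] := follows_optimal hsigma hstar (leq0n N) hr0 hadm fol.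
Qed.
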